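(* Let $(M,L)$ be a time orientable Lorentz-Finsler manifold. If $t_0$ and $t_0'$ are two privileged time orientations on $(M,L)$, then for any $x\in M$ and in any local chart around $x$, $$\sqrt{\left|\det g^{t_0}(x)\right|}=\sqrt{\left|\det g^{t_0'}(x)\right|},$$ that is, the Riemannian volume forms coincide: $dV_{g^{t_0}}=dV_{g^{t_0'}}$. Consequently, if $(M,L)$ admits at least one privileged time orientation, the minimal Riemannian volume form $dV_{bh}:=dV_{g^{t_0}}$, with $t_0$ any privileged time orientation, does not depend on the choice of $t_0$.
   Context: $M$ is a connected, orientable, $C^\infty$-smooth manifold of dimension $n$, $\pi:TM\to M$ its tangent bundle; only positively oriented bases and orientation-preserving coordinate changes are used. $\Gamma(E)$ denotes the set of sections of a fibered manifold $E$ over $M$. Lorentz-Finsler manifold: $A\subset TM$ is a non-empty open submanifold with $\pi(A)=M$, containing no zero vector, such that each $A_x:=T_xM\cap A$ is a positive conic set ($y\in A_x$, $\alpha>0$ implies $\alpha y\in A_x$); elements of $A_x$ are called admissible vectors. $L:A\to\mathbb{R}$ is a smooth function such that, in any induced local chart and at any $(x,y)\in A$: (1) $L(x,\alpha y)=\alpha^2L(x,y)$ for all $\alpha>0$; (2) $g_{ij}(x,y):=\frac12\frac{\partial^2L}{\partial y^i\partial y^j}(x,y)$ are the components of a quadratic form with $n-1$ negative eigenvalues and $1$ positive eigenvalue. For $(x,y)\in A$, with $(y^i)$ the coordinates in a basis $\{b_i\}$ of $T_xM$, $g_{(x,y)}$ denotes the symmetric bilinear form on $T_xM$ with $g_{(x,y)}(b_i,b_j)=g_{ij}(x,y)$.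 Let $A^{+}=\{(x,y)\in A: L(x,y)>0\}$ (timelike vectors). A time orientation is a smooth section $x\mapsto t_x$ of $A^{+}$. $(M,L)$ is time orientable if a time orientation exists. For a time orientation $t$, $g^t$ is the pseudo-Riemannian metric on $M$ given by $g^t_x:=g_{(x,t_x)}$, and $dV_{g^t}=\sqrt{|\det g^t(x)|}\,dx^0\wedge\dots\wedge dx^{n-1}$ is its Riemannian volume form, where $\det g^t(x)$ is the determinant of the matrix $g^t_{ij}(x)=g^t_x(\partial/\partial x^i,\partial/\partial x^j)$. For a compact domain $D\subset M$, the functional $S_D:\Gamma(A^{+})\to\mathbb{R}$ is $S_D(t)=\int_D dV_{g^t}$. Critical points are understood in the usual sense of the calculus of variations: $t$ is a critical point of $S_D$ if $\frac{d}{ds}\big|_{s=0}S_D(t+s\xi)=0$ for every smooth vector field $\xi$ on $M$ with compact support contained in the interior of $D$; critical values are the values of $S_D$ at critical points. A privileged time orientation on $(M,L)$ is a time orientation $t_0\in\Gamma(A^{+})$ such that, for any compact domain $D\subset M$, $S_D(t_0)$ is a minimum of the set of critical values of $S_D$. *)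

(* Defs.v *)
From HB Require Import structures.
From mathcomp Require Import all_boot all_order all_algebra.
From mathcomp Require Import all_classical all_reals all_analysis.
From mathcomp Require Import ring.

Set Implicit Arguments.
Unset Strict Implicit.
Unset Printing Implicit Defensive.

Import Order.TTheory GRing.Theory Num.Theory.
Import numFieldNormedType.Exports.

Local Open Scope classical_set_scope.
Local Open Scope ring_scope.

(* In finite dimension, f is C^(k+1) on the open set O iff it is differentiable
   on O and all its directional derivatives are C^k on O. *)
Fixpoint Ck_on (R : realType) (V W : normedModType R) (k : nat) (O : set V)
    (f : V -> W) : Prop :=
  match k with
  | 0 => forall x, O x -> {for x, continuous f}
  | k'.+1 => (forall x, O x -> differentiable f x) /\
             (forall v, Ck_on k' O ('D_v f))
  end.

Definition smooth_on (R : realType) (V W : normedModType R) (O : set V)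
    (f : V -> W) : Prop := forall k, Ck_on k O f.

Record chart (R : realType) (n : nat) (M : topologicalType) := Chart {
  cdom : set M;
  cmap : M -> 'rV[R]_n;
  cinv : 'rV[R]_n -> M;
  cdom_open : open cdom;
  cimg_open : open (cmap @` cdom);
  cmapK : forall x, cdom x -> cinv (cmap x) = x;
  cmap_cont : forall x, cdom x -> {for x, continuous cmap};
  cinv_cont : forall p, (cmap @` cdom) p -> {for p, continuous cinv}
}.

Section Transition.
Context {R : realType} {n : nat} {M : topologicalType}.
Implicit Types c d : chart R n M.

Definition transition c d : 'rV[R]_n -> 'rV[R]_n := cmap d \o cinv c.

Definition transition_dom c d : set 'rV[R]_n := cmap c @` (cdom c `&` cdom d).

Definition oriented_compatible c d : Prop :=
  smooth_on (transition_dom c d) (transition c d) /\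
  forall p, transition_dom c d p -> 0 < \det ('J (transition c d) p).

Lemma transition_dom_open c d : open (transition_dom c d).
Proof.
rewrite openE => p [x [cx dx] <-{p}] /=.
have Px : (cmap c @` cdom c) (cmap c x) by exists x.
have ox : nbhs (cmap c x) (cmap c @` cdom c).
  by apply: open_nbhs_nbhs; split => //; exact: cimg_open.
have dn : nbhs (cmap c x) (cinv c @^-1` cdom d).
  apply: (cinv_cont Px); rewrite cmapK//.
  by apply: open_nbhs_nbhs; split => //; exact: cdom_open.
apply: filterS (filterI ox dn) => q [[y cy <-]] /=.
by rewrite cmapK// => dy; exists y.
Qed.

End Transition.

(* The atlas is the maximal oriented one: its members are all the positively
   oriented local charts. *)
Record orientedManifold (R : realType) (n : nat) := OrientedManifold {
  carrier :> topologicalType;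
  carrier_hausdorff : hausdorff_space carrier;
  carrier_second_countable : @second_countable carrier;
  carrier_connected : connected [set: carrier];
  atlas : set (chart R n carrier);
  atlas_cover : forall x, exists2 c, atlas c & cdom c x;
  atlas_compatible : forall c d, atlas c -> atlas d -> oriented_compatible c d;
  atlas_maximal : forall c, (forall d, atlas d ->
    oriented_compatible c d /\ oriented_compatible d c) -> atlas c
}.

Section ChartsAt.
Context {R : realType} {n : nat} {M : orientedManifold R n}.

Definition chart_around (x : M) (c : chart R n M) : Prop :=
  atlas c /\ cdom c x.

Definition chart_at (x : M) := {c : chart R n M | chart_around x c}.

Definition some_chart_at (x : M) : chart_at x :=
  let: exist2 c Ac cx := cid2 (atlas_cover x) in exist _ c (conj Ac cx).

Definition jac (x : M) (c d : chart_at x) : 'M[R]_n :=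
  'J (transition (sval c) (sval d)) (cmap (sval c) x).

Lemma near_eq_deriveE (V W : normedModType R) (f g : V -> W) (a v : V) :
  derivable f a v -> (\forall z \near a, f z = g z) -> 'D_v f a = 'D_v g a.
Proof.
move=> df fg; rewrite /derive; apply/esym/cvg_lim => //.
apply: cvg_trans df; apply: near_eq_cvg.
have fga : f a = g a by exact: nbhs_singleton fg.
have h0 : (fun h : R => h *: v + a) @ 0^' --> a.
  have h1 : (fun h : R => h *: v + a) @ (0 : R) --> 0 *: v + a.
    by apply: cvgD; [apply: cvgZr_tmp; exact: cvg_id|exact: cvg_cst].
  move: h1; rewrite scale0r add0r => h1 P /h1 hP.
  exact: nbhs_dnbhs hP.
have : \forall h \near (0 : R)^', f (h *: v + a) = g (h *: v + a).
  exact: h0 fg.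
by apply: filterS => h /= ->; rewrite fga.
Qed.

Lemma derive_comp (U V W : normedModType R) (f : U -> V) (g : V -> W) (a v : U) :
  differentiable f a -> differentiable g (f a) ->
  'D_v (g \o f) a = 'D_('D_v f a) g (f a).
Proof.
move=> df dg; rewrite !deriveE//; last exact: differentiable_comp.
by rewrite diff_comp.
Qed.

Lemma transition_differentiable (x : M) (c d : chart_at x) :
  differentiable (transition (sval c) (sval d)) (cmap (sval c) x).
Proof.
case: c d => [c [Ac cx]] [d [Ad dx]] /=.
have [/(_ 1%N)[/= + _] _] := atlas_compatible Ac Ad.
by apply; exists x.
Qed.

Lemma mul_jac (x : M) (c d : chart_at x) (v : 'rV[R]_n) :
  v *m jac c d = 'D_v (transition (sval c) (sval d)) (cmap (sval c) x).
Proof.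
rewrite deriveE; last exact: transition_differentiable.
by rewrite /jac /jacobian mul_rV_lin1.
Qed.

Lemma jacM (x : M) (c d e : chart_at x) : jac c e = jac c d *m jac d e.
Proof.
have dcd := transition_differentiable c d.
have dx : cinv (sval c) (cmap (sval c) x) = x.
  by rewrite cmapK//; case: (svalP c).
have dde : differentiable (transition (sval d) (sval e))
    (transition (sval c) (sval d) (cmap (sval c) x)).
  by rewrite /transition /= dx; exact: transition_differentiable d e.
apply/row_matrixP => i; rewrite !rowE mulmxA; set v := delta_mx _ _.
transitivity ('D_v (transition (sval c) (sval e)) (cmap (sval c) x)).
  exact: mul_jac.
transitivity ('D_('D_v (transition (sval c) (sval d)) (cmap (sval c) x))
    (transition (sval d) (sval e)) (cmap (sval d) x)); last first.
  by rewrite -mul_jac -mul_jac.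
have fx : transition (sval c) (sval d) (cmap (sval c) x) = cmap (sval d) x.
  by rewrite /transition /= dx.
have := derive_comp v dcd dde; rewrite fx => <-.
apply: near_eq_deriveE.
- apply: diff_derivable; exact: transition_differentiable.
- have xcd : transition_dom (sval c) (sval d) (cmap (sval c) x).
    by exists x => //; split; [case: (svalP c)|case: (svalP d)].
  have := open_nbhs_nbhs (conj (@transition_dom_open _ _ _ (sval c) (sval d)) xcd).
  apply: filterS => _ [y [cy dy] <-]; rewrite /transition /= cmapK//.
  by rewrite cmapK.
Qed.

End ChartsAt.

Section TangentSpace.
Context {R : realType} {n : nat} {M : orientedManifold R n}.

(* A tangent vector at x is a family of components, one row for each local chart
   around x, related by the Jacobian matrices of the chart changes; with row
   vectors, 'J f p acts on the right. *)
Definition components_law (x : M) : {pred (chart_at x -> 'rV[R]_n)} :=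
  fun v => `[< forall c d, v d = v c *m jac c d >].

Record tangent (x : M) := Tangent {
  coord :> chart_at x -> 'rV[R]_n;
  coordP : coord \in @components_law x
}.

HB.instance Definition _ (x : M) := [isSub for (@coord x)].
HB.instance Definition _ (x : M) := gen_eqMixin (tangent x).
HB.instance Definition _ (x : M) := gen_choiceMixin (tangent x).

Lemma components_law_submod (x : M) : submod_closed (@components_law x).
Proof.
split; first by apply/asboolP => c d; rewrite mul0mx.
move=> a u v /asboolP hu /asboolP hv; apply/asboolP => c d.
by rewrite !fctE /= (hu c d) (hv c d) mulmxDl -scalemxAl.
Qed.

HB.instance Definition _ (x : M) :=
  GRing.isSubmodClosed.Build R (chart_at x -> 'rV[R]_n) (@components_law x)
    (@components_law_submod x).

HB.instance Definition _ (x : M) :=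
  [SubChoice_isSubLmodule of (tangent x) by <:].

Lemma vect_subproof (x : M) (c : chart_at x) (y : 'rV[R]_n) :
  (fun d => y *m jac c d) \in @components_law x.
Proof. by apply/asboolP => d e; rewrite (jacM c d e) mulmxA. Qed.

Definition vect (x : M) (c : chart_at x) (y : 'rV[R]_n) : tangent x :=
  Tangent (vect_subproof c y).

(* The chart c, seen as a chart around x; a junk value unless c is a local
   chart around x. *)
Definition at_chart (c : chart R n M) (x : M) : chart_at x :=
  if pselect (chart_around x c) is left h then exist _ c h
  else some_chart_at x.

Definition vector_field := forall x : M, tangent x.

Definition smooth_field (t : vector_field) : Prop :=
  forall c, atlas c -> smooth_on (cmap c @` cdom c)
    (fun p => t (cinv c p) (at_chart c (cinv c p))).

Definition field_support (t : vector_field) : set M :=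
  closure [set x | t x != 0].

End TangentSpace.

Arguments vector_field {R n} M.

Section LorentzFinsler.
Context {R : realType} {n : nat} {M : orientedManifold R n}.

(* Components g_ij = (1/2) d^2 L / dy^i dy^j at the tangent vector v, in the
   natural basis of the chart c. *)
Definition fundamental_mx (L : forall x : M, tangent x -> R) (x : M)
    (v : tangent x) (c : chart_at x) : 'M[R]_n :=
  \matrix_(i, j) (2^-1 *
    'D_(delta_mx 0 i) ('D_(delta_mx 0 j) (fun y => L x (vect c y))) (v c)).

(* s lists the eigenvalues of G with multiplicity; it has size n, so the two
   counts also exclude the eigenvalue 0. *)
Definition lorentzian_signature (G : 'M[R]_n) : Prop :=
  exists s : seq R, [/\ char_poly G = \prod_(a <- s) ('X - a%:P),
    count (fun a => a < 0) s = n.-1 & count (fun a => 0 < a) s = 1%N].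

(* Domain of an induced chart of TM intersected with A, and the expression of L
   in such a chart. *)
Definition induced_dom (A : forall x : M, set (tangent x)) (c : chart R n M) :
    set ('rV[R]_n * 'rV[R]_n) :=
  [set q | (cmap c @` cdom c) q.1 /\
           A (cinv c q.1) (vect (at_chart c (cinv c q.1)) q.2)].

Definition induced_expr (L : forall x : M, tangent x -> R) (c : chart R n M)
    (q : 'rV[R]_n * 'rV[R]_n) : R :=
  L (cinv c q.1) (vect (at_chart c (cinv c q.1)) q.2).

End LorentzFinsler.

(* L is only meaningful on A; its values outside A are irrelevant. *)
Record lorentzFinsler (R : realType) (n : nat) (M : orientedManifold R n) :=
  LorentzFinsler {
  admissible : forall x : M, set (tangent x);
  lagrangian : forall x : M, tangent x -> R;
  admissible_nonempty : exists x, admissible (x := x) !=set0;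
  admissible_open : forall c, atlas c -> open (induced_dom admissible c);
  admissible_onto : forall x, admissible (x := x) !=set0;
  admissible_neq0 : forall x (y : tangent x), admissible y -> y != 0;
  admissible_conic : forall x (y : tangent x) (a : R),
    admissible y -> 0 < a -> admissible (a *: y);
  lagrangian_smooth : forall c, atlas c ->
    smooth_on (induced_dom admissible c) (induced_expr lagrangian c);
  lagrangian_homogeneous : forall x (y : tangent x) (a : R),
    admissible y -> 0 < a -> lagrangian (a *: y) = a ^+ 2 * lagrangian y;
  lagrangian_signature : forall x (y : tangent x) (c : chart_at x),
    admissible y -> lorentzian_signature (fundamental_mx lagrangian y c)
}.

Section TimeOrientation.
Context {R : realType} {n : nat} {M : orientedManifold R n}.
Context (F : lorentzFinsler M).

Definition timelike (x : M) : set (tangent x) :=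
  [set y | admissible F y /\ 0 < lagrangian F y].

Definition time_orientation (t : vector_field M) : Prop :=
  smooth_field t /\ forall x, timelike (t x).

Definition time_orientable : Prop := exists t, time_orientation t.

(* g^t_x = g_(x, t_x), in the natural basis of the chart c. *)
Definition metric_mx (t : vector_field M) (x : M) (c : chart_at x) : 'M[R]_n :=
  fundamental_mx (lagrangian F) (t x) c.

Definition volume_coef (t : vector_field M) (x : M) (c : chart_at x) : R :=
  Num.sqrt `|\det (metric_mx t c)|.

End TimeOrientation.

(* The library has no Lebesgue measure on 'rV[R]_n; it is obtained on n-tuples as
   an iterated product measure and transported by row_of. *)
Section LebesgueTuple.
Context {R : realType}.
Local Notation mR := (measurableTypeR R).

Definition tcons (n : nat) (p : mR * n.-tuple mR) : n.+1.-tuple mR :=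
  [the n.+1.-tuple mR of p.1 :: p.2].

Lemma measurable_tcons (n : nat) : measurable_fun setT (@tcons n).
Proof. exact: measurable_cons. Qed.

Lemma tcons_sigma_finite (n : nat)
    (m : {sigma_finite_measure set (n.-tuple mR) -> \bar R}) :
  sigma_finite setT
    (pushforward (product_measure1 (@lebesgue_measure R) m) (@tcons n)).
Proof.
have [G GT Goo] : sigma_finite setT (product_measure1 (@lebesgue_measure R) m).
  have /sigma_finiteP[A [TA ndA Aoo]] := sigma_finiteT (@lebesgue_measure R).
  have /sigma_finiteP[B [TB ndB Boo]] := sigma_finiteT m.
  exists (fun k => A k `*` B k).
    rewrite -setXTT TA TB; apply/seteqP; split=> [[x y]|[x y]].
      move=> [/= [i _ Aix] [j _ Bjy]]; exists (maxn i j) => //; split.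
        by move: x Aix; exact/subsetPset/ndA/leq_maxl.
      by move: y Bjy; exact/subsetPset/ndB/leq_maxr.
    by move=> [k _ []/= ? ?]; split; exists k.
  move=> k; have [? ?] := Aoo k; have [? ?] := Boo k.
  split; first exact: measurableX.
  by rewrite product_measure1E// lte_mul_pinfty// ge0_fin_numE.
pose u (x : n.+1.-tuple mR) : mR * n.-tuple mR := (thead x, [tuple of behead x]).
have mu : measurable_fun setT u.
  apply: measurable_fun_pair; last exact: measurable_behead.
  exact: measurable_tnth.
have uK p : u (tcons p) = p.
  case: p => a b; rewrite /u /tcons /=; congr pair.
  exact: val_inj.
exists (fun k => u @^-1` G k).
  by rewrite -preimage_bigcup -GT preimage_setT.
move=> k; have [mG Gk] := Goo k; split.
  by rewrite -[X in measurable X]setTI; exact: mu.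
rewrite /pushforward (_ : _ @^-1` _ = G k)//.
by apply/seteqP; split=> p /=; rewrite uK.
Qed.

Definition lebesgue_tuple_step (n : nat)
    (m : {sigma_finite_measure set (n.-tuple mR) -> \bar R}) :
    set (n.+1.-tuple mR) -> \bar R :=
  pushforward (product_measure1 (@lebesgue_measure R) m) (@tcons n).

HB.instance Definition _ n m := Measure.copy (@lebesgue_tuple_step n m)
  (measure_function_pushforward__canonical__measure_function_Measure
     (product_measure1 (@lebesgue_measure R) m) (@measurable_tcons n)).
HB.instance Definition _ n m := Measure_isSigmaFinite.Build _ _ _
  (@lebesgue_tuple_step n m) (@tcons_sigma_finite n m).

Fixpoint lebesgue_tuple (n : nat) :
    {sigma_finite_measure set (n.-tuple mR) -> \bar R} :=
  match n with
  | 0 => [the {sigma_finite_measure set (0.-tuple mR) -> \bar R} of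
            dirac ([tuple] : 0.-tuple mR)]
  | k.+1 => [the {sigma_finite_measure set (k.+1.-tuple mR) -> \bar R} of
               lebesgue_tuple_step (lebesgue_tuple k)]
  end.

Definition row_of (n : nat) (x : n.-tuple mR) : 'rV[R]_n :=
  \row_(i < n) tnth x i.

Definition integral_rV (n : nat) (D : set 'rV[R]_n) (f : 'rV[R]_n -> R) : R :=
  (\int[lebesgue_tuple n]_(x in [set x | D (row_of x)]) f (row_of x))%R.

End LebesgueTuple.

Section Integration.
Context {R : realType} {n : nat} {M : orientedManifold R n}.

Record weighted_charts := WeightedCharts {
  wc_size : nat;
  wc_chart : 'I_wc_size -> chart R n M;
  wc_weight : 'I_wc_size -> M -> R
}.

(* The weights are only used for integration, where continuity suffices. *)
Definition partition_of_unity (D : set M) (P : weighted_charts) : Prop :=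
  [/\ forall k, atlas (@wc_chart P k),
      forall k, continuous (@wc_weight P k),
      forall k x, 0 <= @wc_weight P k x,
      forall k, closure [set x | @wc_weight P k x != 0] `<=`
                cdom (@wc_chart P k) &
      forall x, D x -> \sum_(k < wc_size P) @wc_weight P k x = 1].

(* Integral over D of the density with coefficient w x c at x in the chart c.
   The partition of unity is chosen once for each D (any choice gives the same
   value when w obeys the transformation law of densities). *)
Definition integral_density (D : set M) (w : forall x : M, chart_at x -> R) : R :=
  if pselect (exists P, partition_of_unity D P) is left e then
    let P := sval (cid e) in
    \sum_(k < wc_size P)
      let c := @wc_chart P k in
      integral_rV (cmap c @` (D `&` cdom c))
        (fun p => @wc_weight P k (cinv c p) *
                  w (cinv c p) (at_chart c (cinv c p)))
  else 0.

(* A domain is a non-empty connected open set; D is the closure of one. *)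
Definition compact_domain (D : set M) : Prop :=
  compact D /\
  exists G : set M, [/\ open G, G !=set0, connected G & D = closure G].

End Integration.

Section Privileged.
Context {R : realType} {n : nat} {M : orientedManifold R n}.
Context (F : lorentzFinsler M).

Definition volume_functional (D : set M) (t : vector_field M) : R :=
  integral_density D (volume_coef F t).

(* For s close to 0, t + s xi is again a section of A^+; only the germ of the
   function of s at 0 matters. *)
Definition critical_point (D : set M) (t : vector_field M) : Prop :=
  time_orientation F t /\
  forall xi : vector_field M, smooth_field xi ->
    compact (field_support xi) -> field_support xi `<=` interior D ->
    is_derive (0 : R) 1
      (fun s : R => volume_functional D (fun x => t x + s *: xi x)) 0.

Definition critical_values (D : set M) : set R :=
  [set volume_functional D t | t in critical_point D].

Definition privileged (t0 : vector_field M) : Prop :=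
  time_orientation F t0 /\
  forall D, compact_domain D ->
    critical_values D (volume_functional D t0) /\
    lbound (critical_values D) (volume_functional D t0).

(* dV_{g^t}: the n-form sqrt |det g^t(x)| dx^0 /\ ... /\ dx^(n-1), evaluated on
   n tangent vectors at x; the chart is immaterial, see volume_formE below. *)
Definition volume_form (t : vector_field M) (x : M)
    (v : 'I_n -> tangent x) : R :=
  let c := some_chart_at x in
  volume_coef F t c * \det (\matrix_(i < n, j < n) v i c 0 j).

End Privileged.

Section ChartIndependence.
Context {R : realType} {n : nat} {M : orientedManifold R n}.
Context (F : lorentzFinsler M).

Lemma at_chartE (x : M) (c : chart_at x) : at_chart (sval c) x = c.
Proof.
rewrite /at_chart; case: pselect => [h|]; last by move/(_ (svalP c)).
by case: c h => c p h /=; congr exist; exact: Prop_irrelevance.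
Qed.

Lemma vect_jac (x : M) (c d : chart_at x) (y : 'rV[R]_n) :
  vect c y = vect d (y *m jac c d).
Proof. by apply/val_inj/funext => e /=; rewrite (jacM c d e) mulmxA. Qed.

Section SecondDerivatives.
Context (x : M) (d : chart_at x) (w : tangent x) (hw : admissible F w).

Let g := induced_expr (lagrangian F) (sval d).
Let O := induced_dom (admissible F) (sval d).
Let p := cmap (sval d) x.
Let f (y : 'rV[R]_n) : R := lagrangian F (vect d y).

Let cinvp : cinv (sval d) p = x.
Proof. by rewrite /p cmapK//; case: (svalP d). Qed.

Let vectK : vect d (w d) = w.
Proof.
by apply/val_inj/funext => e; have /asboolP/(_ d e) := coordP w.
Qed.

Let gE y : g (p, y) = f y.
Proof. by rewrite /g /induced_expr /= cinvp at_chartE. Qed.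

Let Opw : O (p, w d).
Proof.
split => /=; first by exists x => //; case: (svalP d).
by rewrite cinvp at_chartE vectK.
Qed.

Let OP : \forall y \near w d, O (p, y).
Proof.
have Oo : open O by apply: admissible_open; case: (svalP d).
have h : (fun y : 'rV[R]_n => (p, y)) @ w d --> (p, w d).
  apply: (@differentiable_continuous _ _ _ (w d) (fun y : 'rV[R]_n => (p, y))).
  exact: differentiable_pair.
exact: h _ (open_nbhs_nbhs (conj Oo Opw)).
Qed.

Let slice (h : 'rV[R]_n * 'rV[R]_n -> R) (u y : 'rV[R]_n) :
  'D_(0, u) h (p, y) = 'D_u (fun z => h (p, z)) y.
Proof.
rewrite /derive (_ : (fun s : R => _) = fun s : R =>
  s^-1 *: (((fun z => h (p, z)) \o shift y) (s *: u) - h (p, y)))//.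
apply/funext => s /=; congr (_ *: (h _ - _)).
by congr pair; rewrite /= scaler0 add0r.
Qed.

Let slice_diff (h : 'rV[R]_n * 'rV[R]_n -> R) (y : 'rV[R]_n) :
  differentiable h (p, y) -> differentiable (fun z => h (p, z)) y.
Proof.
by move=> dh; apply: (@differentiable_comp _ _ _ _ (fun z => (p, z)) h).
Qed.

Let gsm : smooth_on O g.
Proof. by apply: lagrangian_smooth; case: (svalP d). Qed.

Let fE : f = fun y => g (p, y).
Proof. by apply/funext => y; rewrite gE. Qed.

Let df : \forall y \near w d, differentiable f y.
Proof.
apply: filterS OP => y Oy; rewrite fE; apply: slice_diff.
by have [/(_ _ Oy)] := gsm 1%N.
Qed.

Let ddf (u : 'rV[R]_n) : differentiable ('D_u f) (w d).
Proof.
have -> : 'D_u f = fun y => ('D_(0, u) g) (p, y).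
  by apply/funext => y; rewrite slice fE.
apply: (@slice_diff ('D_(0, u) g)).
by have [_ /(_ (0, u))[/(_ _ Opw)]] := gsm 2%N.
Qed.

Lemma hessian_linearr (u v v' : 'rV[R]_n) (a : R) :
  'D_u ('D_(a *: v + v') f) (w d) =
  a *: 'D_u ('D_v f) (w d) + 'D_u ('D_v' f) (w d).
Proof.
rewrite (@near_eq_deriveE _ _ _ _ (a \*: 'D_v f + 'D_v' f)).
- rewrite deriveD ?deriveZ//; [exact: diff_derivable| |exact: diff_derivable].
  by apply: derivableZ; exact: diff_derivable.
- exact: diff_derivable.
- apply: filterS df => y dy.
  by rewrite /= !fctE /= !deriveE// linearP.
Qed.

Lemma hessian_linearl (u u' v : 'rV[R]_n) (a : R) :
  'D_(a *: u + u') ('D_v f) (w d) =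
  a *: 'D_u ('D_v f) (w d) + 'D_u' ('D_v f) (w d).
Proof. by rewrite !deriveE// linearP. Qed.

End SecondDerivatives.

Lemma linear_rowE (phi : 'rV[R]_n -> R) (u : 'rV[R]_n) :
  (forall a v v', phi (a *: v + v') = a *: phi v + phi v') ->
  phi u = \sum_k u 0 k * phi (delta_mx 0 k).
Proof.
move=> lin; have phi0 : phi 0 = 0.
  by have := lin (-1) 0 0; rewrite scaler0 addr0 scaleN1r addNr.
rewrite {1}[u]row_sum_delta; elim/big_rec2 : _ => [//|k y v _ <-].
exact: lin.
Qed.

Lemma derive_mulmx (J : 'M[R]_n) (h : 'rV[R]_n -> R) (u y : 'rV[R]_n) :
  'D_u (fun z => h (z *m J)) y = 'D_(u *m J) h (y *m J).
Proof.
rewrite /derive (_ : (fun s : R => _) = fun s : R =>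
  s^-1 *: ((h \o shift (y *m J)) (s *: (u *m J)) - h (y *m J)))//.
by apply/funext => s /=; rewrite mulmxDl scalemxAl.
Qed.

Lemma fundamental_mx_jac (x : M) (c d : chart_at x) (w : tangent x) :
  admissible F w ->
  fundamental_mx (lagrangian F) w c =
  jac c d *m fundamental_mx (lagrangian F) w d *m (jac c d)^T.
Proof.
move=> hw; apply/matrixP => i j; rewrite !mxE.
set J := jac c d.
pose f y := lagrangian F (vect d y).
have -> : (fun y => lagrangian F (vect c y)) = fun y => f (y *m J).
  by apply/funext => y; rewrite (vect_jac c d).
have -> : 'D_(delta_mx 0 j) (fun y => f (y *m J)) =
    fun y => 'D_(delta_mx 0 j *m J) f (y *m J).
  by apply/funext => y; rewrite derive_mulmx.
rewrite (derive_mulmx J ('D_(delta_mx 0 j *m J) f)).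
have <- : w d = w c *m J by have /asboolP := coordP w; exact.
rewrite (linear_rowE (phi := fun u => 'D_u _ _)); last first.
  by move=> a v v'; exact: hessian_linearl.
under eq_bigr => k _.
  rewrite (linear_rowE (phi := fun v => 'D_(delta_mx 0 k) ('D_v f) (w d))); last first.
    by move=> a v v'; exact: hessian_linearr.
  over.
rewrite mulr_sumr; under [RHS]eq_bigr => l _ do rewrite !mxE mulr_suml.
rewrite exchange_big /=; apply: eq_bigr => k _.
rewrite !mulr_sumr; apply: eq_bigr => l _.
rewrite -!rowE !mxE /f; ring.
Qed.

Lemma volume_formE (t : vector_field M) (x : M) (c : chart_at x)
    (v : 'I_n -> tangent x) : admissible F (t x) ->
  volume_form F t v = volume_coef F t c * \det (\matrix_(i, j) v i c 0 j).
Proof.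
move=> ht; rewrite /volume_form; set d := some_chart_at x.
have Jpos : 0 < \det (jac c d).
  have [Ac cx] := svalP c; have [Ad dx] := svalP d.
  have [_ ] := atlas_compatible Ac Ad; apply.
  by exists (x : M).
have -> : \matrix_(i, j) v i d 0 j = (\matrix_(i, j) v i c 0 j) *m jac c d.
  apply/matrixP => i j; rewrite mxE.
  have /asboolP/(_ c d) -> := coordP (v i).
  rewrite [LHS]mxE [RHS]mxE; apply: eq_bigr => k _.
  by congr (_ * _); rewrite mxE.
rewrite /volume_coef /metric_mx (fundamental_mx_jac c d ht).
rewrite !det_mulmx det_tr mulrAC -expr2 normrM sqrtrM// normrX sqrtr_sqr.
rewrite normr_id (gtr0_norm Jpos); ring.
Qed.

End ChartIndependence.

(* Main.v *)
Require Import Defs.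
From mathcomp Require Import all_boot all_order all_algebra.
From mathcomp Require Import all_classical all_reals all_analysis.
From mathcomp Require Import measurable_realfun lra.

(** Two privileged time orientations t0 and t0' have the same volume on every
    compact domain D: both volumes are critical values of S_D, and each is a
    lower bound of the set of critical values
    (privileged_eq_volume_functional). Volumes on arbitrarily small domains
    determine the density. Indeed, if the coefficient of dV_(g^t) at some point
    x is smaller than that of dV_(g^t') in one chart, then by continuity
    (volume_coef_continuous) it is smaller on a neighbourhood of x, and by the
    transformation law of densities (volume_coef_lt_jac) it is smaller there in
    every chart. A small closed coordinate ball D around x is a compact domain
    on which S_D(t) < S_D(t') (volume_functional_separates).

    The integral over D is the sum of chart integrals weighted by one partition
    of unity, chosen from D alone. The same partition thus serves both
    densities, which can be compared chart by chart with no change of variables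
    (integral_density_lt). Two facts are needed for this: a partition of unity
    exists for D, as otherwise the integral is 0 by convention
    (coordinate_ball_partition); and the Lebesgue integral of rows is strictly
    monotone for continuous functions on compact sets (lt_integral_rV). The
    latter rests on the measurability of open sets of rows and on the volume of
    cubes. *)

Set Implicit Arguments.
Unset Strict Implicit.
Unset Printing Implicit Defensive.

Import Order.TTheory GRing.Theory Num.Theory.
Import numFieldNormedType.Exports.

Local Open Scope classical_set_scope.
Local Open Scope ring_scope.

(** * Lebesgue measure of open and compact sets of rows *)

Section LebesgueRows.
Context {R : realType} {n : nat}.
Local Notation mR := (measurableTypeR R).

(** The norm of rows is the supremum norm, so balls are cubes. *)
Lemma preimage_row_of_ball (p : 'rV[R]_n) (e : R) : 0 < e ->
  @row_of R n @^-1` ball p e = [set x | forall i, ball (p 0 i) e (tnth x i)].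
Proof.
move=> e0; apply/seteqP; split=> x /=.
  by move=> [_ h] i; have := h 0 i; rewrite mxE.
by move=> h; split=> // i j; rewrite ord1 mxE.
Qed.

Lemma measurable_row_of_ball (p : 'rV[R]_n) (e : R) : 0 < e ->
  measurable (@row_of R n @^-1` ball p e).
Proof.
move=> e0; rewrite preimage_row_of_ball//.
rewrite (_ : [set _ | _] =
    \bigcap_i (fun x : n.-tuple mR => tnth x i) @^-1` ball (p 0 i) e); last first.
  by apply/seteqP; split=> x /= h i => [_|]; exact: h.
apply: fin_bigcap_measurable => // i _.
rewrite -[X in measurable X]setTI; apply: measurable_tnth => //.
by apply: open_measurable; exact: ball_open.
Qed.

(** An open set is a countable union of balls with rational centre and radius,
    and the cubes that they are belong to the product sigma-algebra. *)
Lemma measurable_row_of_open (U : set 'rV[R]_n) :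
  open U -> measurable (@row_of R n @^-1` U).
Proof.
move=> oU.
pose center (q : n.-tuple rat) : 'rV[R]_n := \row_i ratr (tnth q i).
pose b (q : n.-tuple rat * rat) : set 'rV[R]_n :=
  [set y | 0 < ratr q.2 :> R /\ ball (center q.1) (ratr q.2) y].
pose B (q : n.-tuple rat * rat) :=
  if pselect (b q `<=` U) then b q else set0.
have -> : U = \bigcup_q B q.
  apply/seteqP; split=> [y Uy|y [q _]]; last first.
    by rewrite /B; case: pselect => // bU; exact: bU.
  have /nbhs_ballP[e /= e0 eU] := open_nbhs_nbhs (conj oU Uy).
  (* The rational centre is at distance less than r of y, with 2 r < e, so the
     rational ball of radius r contains y and stays in the ball of radius e. *)
  have e4 : e / 4 < e / 2 by lra.
  have [r /[!in_itv]/= /andP[r1 r2]] := rat_in_itvoo e4.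
  have r0 : 0 < ratr r :> R by lra.
  have yr i : y 0 i - ratr r < y 0 i + ratr r by lra.
  pose q := [tuple projT1 (cid (rat_in_itvoo (yr i))) | i < n].
  have qE i : `|ratr (tnth q i) - y 0 i| < ratr r.
    rewrite tnth_mktuple; case: cid => /= u /[!in_itv]/= u1.
    by rewrite ltr_norml; lra.
  exists (q, r) => //; rewrite /B; case: pselect => [bU|]; last case.
    by split=> //; split=> // i j; rewrite ord1 mxE; exact: qE.
  move=> z [_ [_ zr]]; apply: eU; split=> // i j; rewrite ord1.
  have := zr 0 j; rewrite mxE /= /ball /= => zj; have := qE j.
  by move: zj; rewrite !ltr_norml; lra.
rewrite preimage_bigcup; apply: countable_bigcupT_measurable => [|q].
  exact: countableP.
rewrite /B; case: pselect => [bU|nbU] /=; last by rewrite preimage_set0.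
rewrite /b; have [q0|q0] := ltP 0 (ratr q.2 : R).
  rewrite (_ : [set y | _] = ball (center q.1) (ratr q.2)).
    exact: measurable_row_of_ball.
  by apply/seteqP; split=> y // [].
rewrite (_ : [set y | _] = set0) ?preimage_set0//.
by apply/seteqP; split=> y // [].
Qed.

Lemma measurable_row_of_compact (K : set 'rV[R]_n) :
  compact K -> measurable (@row_of R n @^-1` K).
Proof.
move=> /(compact_closed (@norm_hausdorff _ _)) cK.
rewrite -[K]setCK preimage_setC; apply: measurableC.
exact: (measurable_row_of_open (closed_openC cK)).
Qed.

End LebesgueRows.

Lemma lebesgue_tuple_ball (R : realType) (n : nat) (p : 'rV[R]_n) (e : R) :
  0 < e ->
  lebesgue_tuple n (@row_of R n @^-1` ball p e) = ((e *+ 2) ^+ n)%:E.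
Proof.
elim: n p => [|n IHn] p e0.
  have B : (@row_of R 0 @^-1` ball p e) [tuple].
    by rewrite preimage_row_of_ball// => -[].
  by rewrite /= diracE mem_set.
rewrite /= /lebesgue_tuple_step /pushforward.
(* A cube is the product of its first side and of a cube of one dimension
   less. *)
rewrite [X in product_measure1 _ _ X](_ : _ = ball (p 0 ord0) e `*`
    (@row_of R n @^-1` ball (\row_i p 0 (lift ord0 i)) e)); last first.
  rewrite !preimage_row_of_ball//; apply/seteqP; split=> -[a x] /=.
    move=> h; split; first by have := h ord0; rewrite tnth0.
    by move=> i; rewrite mxE; have := h (lift ord0 i); rewrite tnthS.
  move=> [h0 h] i; have [j ->|->] := unliftP ord0 i; last by rewrite tnth0.
  by rewrite tnthS; have := h j; rewrite mxE.
rewrite product_measure1E; [|by apply: open_measurable; exact: ball_open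
                            |exact: measurable_row_of_ball].
rewrite IHn// exprS EFinM; congr (_ * _)%E.
exact/lebesgue_measure_ball/ltW.
Qed.

(** * Integrals of continuous functions on compact sets of rows *)

Section IntegralRows.
Context {R : realType} {n : nat}.
Local Notation mR := (measurableTypeR R).
Local Notation mu := (lebesgue_tuple (R := R) n).
Implicit Types (D K U : set 'rV[R]_n) (f g : 'rV[R]_n -> R).

Lemma lebesgue_tuple_compact K : compact K -> (mu (@row_of R n @^-1` K) < +oo)%E.
Proof.
move=> cK; have [r [_ Kr]] := compact_bounded cK.
have r0 : 0 < `|r| + 1 + 1 by rewrite addrAC ltr_wpDl// addr_ge0.
apply: (@le_lt_trans _ _ (mu (@row_of R n @^-1` ball 0 (`|r| + 1 + 1)))).
  rewrite le_measure ?inE//; [exact: measurable_row_of_compact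
                             |exact: measurable_row_of_ball|].
  move=> x /= Kx; rewrite -ball_normE /ball_ /= sub0r normrN.
  have := Kr (`|r| + 1); rewrite ltr_pwDr// ?ler_norm// => /(_ isT _ Kx) h.
  by rewrite (le_lt_trans h)// ltrDl.
by rewrite lebesgue_tuple_ball// ltry.
Qed.

Lemma lebesgue_tuple_open_gt0 U : open U -> U !=set0 ->
  (0 < mu (@row_of R n @^-1` U))%E.
Proof.
move=> oU [p Up].
have /nbhs_ballP[e /= e0 eU] := open_nbhs_nbhs (conj oU Up).
apply: (@lt_le_trans _ _ (mu (@row_of R n @^-1` ball p e))).
  by rewrite lebesgue_tuple_ball// lte_fin exprn_gt0// pmulrn_lgt0.
rewrite le_measure ?inE//; [exact: measurable_row_of_ball
                           |exact: measurable_row_of_open|].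
by move=> x /=; exact: eU.
Qed.

(** A continuous function on a compact set is bounded and measurable, and the
    compact set has finite measure. *)
Lemma integrable_row_of_compact K f : compact K ->
  (forall p, K p -> {for p, continuous f}) ->
  mu.-integrable (@row_of R n @^-1` K) (EFin \o (f \o @row_of R n)).
Proof.
move=> cK cf.
have fK : {within K, continuous f}.
  by apply: continuous_in_subspaceT => p /set_mem; exact: cf.
have mK := measurable_row_of_compact cK.
apply: measurable_bounded_integrable => //; first exact: lebesgue_tuple_compact.
- apply: (measurability _ (RGenOpens.measurableE R)).
  move=> _ [_ [a [b ->] <-]].
  have : open ((f : subspace K -> R) @^-1` `]a, b[%classic).
    by move/continuousP: fK; apply; exact: interval_open.
  move=> /open_subspaceP[V oV VE].
  rewrite (_ : _ `&` _ = (@row_of R n @^-1` K) `&` (@row_of R n @^-1` V)).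
    by apply: measurableI => //; exact: measurable_row_of_open.
  apply/seteqP; split=> x /= [Kx h]; split=> //.
    by have [] : (V `&` K) (row_of x) by rewrite VE; split.
  by have [] : (f @^-1` `]a, b[%classic `&` K) (row_of x) by rewrite -VE; split.
- have /compact_bounded[r [rr fr]] := continuous_compact fK cK.
  exists r; split => // s rs x /= Kx.
  by apply: (fr s rs); exists (row_of x).
Qed.

Lemma integral_rV_support D K f : K `<=` D ->
  (forall p, D p -> ~ K p -> f p = 0) -> integral_rV D f = integral_rV K f.
Proof.
move=> KD f0; rewrite /integral_rV Rintegral_mkcond [RHS]Rintegral_mkcond.
congr Rintegral; apply/funext => x; rewrite !patchE.
have [xK|xK] := pselect (K (row_of x)).
  by rewrite !mem_set//=; exact: KD.
rewrite [in RHS]memNset//; case: ifPn => // /set_mem/= xD.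
exact: f0.
Qed.

Lemma le_integral_rV D K f g : compact K -> K `<=` D ->
  (forall p, K p -> {for p, continuous f}) ->
  (forall p, K p -> {for p, continuous g}) ->
  (forall p, D p -> ~ K p -> f p = 0 /\ g p = 0) ->
  (forall p, K p -> f p <= g p) -> integral_rV D f <= integral_rV D g.
Proof.
move=> cK KD cf cg fg0 fg.
rewrite (integral_rV_support KD) => [|p Dp Kp]; last first.
  by have [] := fg0 p Dp Kp.
rewrite [leRHS](integral_rV_support KD) => [|p Dp Kp]; last first.
  by have [] := fg0 p Dp Kp.
apply: le_Rintegral; [exact: measurable_row_of_compact| | |].
- exact: integrable_row_of_compact.
- exact: integrable_row_of_compact.
- by move=> x /=; exact: fg.
Qed.

(** If the integrals were equal, the nonnegative function g - f would vanish
    almost everywhere on K; but it is positive on U, which has positive measure.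
    Since K carries f and g, it replaces D, whose measure may be infinite. *)
Lemma lt_integral_rV D K U f g : compact K -> K `<=` D ->
  (forall p, K p -> {for p, continuous f}) ->
  (forall p, K p -> {for p, continuous g}) ->
  (forall p, D p -> ~ K p -> f p = 0 /\ g p = 0) ->
  (forall p, K p -> f p <= g p) ->
  open U -> U !=set0 -> U `<=` K -> (forall p, U p -> f p < g p) ->
  integral_rV D f < integral_rV D g.
Proof.
move=> cK KD cf cg fg0 fg oU U0 UK fgU.
rewrite lt_neqAle (le_integral_rV cK KD)// andbT; apply/eqP.
rewrite (integral_rV_support KD) => [|p Dp Kp]; last first.
  by have [] := fg0 p Dp Kp.
rewrite [RHS](integral_rV_support KD) => [|p Dp Kp]; last first.
  by have [] := fg0 p Dp Kp.
have mK := measurable_row_of_compact cK.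
have intf := integrable_row_of_compact cK cf.
have intg := integrable_row_of_compact cK cg.
move=> /esym/eqP; rewrite -subr_eq0 -RintegralB// => /eqP int0.
have intgf : mu.-integrable (@row_of R n @^-1` K)
    (EFin \o (fun x => g (row_of x) - f (row_of x))).
  by have := integrableB mK intg intf; exact: eq_integrable.
have : (\int[mu]_(x in @row_of R n @^-1` K)
    `|(g (row_of x) - f (row_of x))%:E| = 0)%E.
  transitivity (\int[mu]_(x in @row_of R n @^-1` K)
    (g (row_of x) - f (row_of x))%:E)%E.
    apply: eq_integral => x /set_mem/= Kx.
    by rewrite ger0_norm// subr_ge0 fg.
  rewrite -[LHS]fineK; first by congr EFin.
  exact: integrable_fin_num.
move=> /(ae_eq_integral_abs mu mK); case/(_ (measurable_int _ intgf)).
move=> N [mN N0 subN].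
have := lebesgue_tuple_open_gt0 oU U0.
apply/negP; rewrite -leNgt -N0 le_measure ?inE//.
  exact: measurable_row_of_open.
move=> x /= Ux; apply: subN => /= /(_ (UK _ Ux)) [] /eqP.
by rewrite subr_eq0 gt_eqF// fgU.
Qed.

End IntegralRows.

(** * Sets seen in a chart *)

Section Charts.
Context {R : realType} {n : nat} {M : topologicalType}.
Implicit Types (c : chart R n M) (D : set M).

Lemma chart_image_open c (O : set M) :
  open O -> O `<=` cdom c -> open (cmap c @` O).
Proof.
move=> oO Oc; rewrite openE => _ [x Ox <-] /=.
have px : (cmap c @` cdom c) (cmap c x) by exists x => //; exact: Oc.
have near_img : nbhs (cmap c x) (cmap c @` cdom c).
  by apply: open_nbhs_nbhs; split => //; exact: cimg_open.
have near_O : nbhs (cmap c x) (cinv c @^-1` O).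
  apply: (cinv_cont px); rewrite cmapK; last exact: Oc.
  exact: open_nbhs_nbhs.
apply: filterS (filterI near_img near_O) => _ [[y cy <-]] /=.
by rewrite cmapK// => Oy; exists y.
Qed.

Lemma chart_preimage_open c (V : set 'rV[R]_n) :
  open V -> V `<=` cmap c @` cdom c -> open (cinv c @` V).
Proof.
move=> oV Vc; rewrite openE => _ [p Vp <-] /=.
have [x cx xp] := Vc _ Vp; rewrite -xp cmapK//.
have near_V : nbhs x (cmap c @^-1` V).
  by apply: (cmap_cont cx); apply: open_nbhs_nbhs; split=> //; rewrite xp.
have near_c : nbhs x (cdom c).
  by apply: open_nbhs_nbhs; split => //; exact: cdom_open.
apply: filterS (filterI near_c near_V) => y [cy Vy].
by exists (cmap c y) => //; rewrite cmapK.
Qed.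

Lemma chart_image_compact c D :
  compact D -> D `<=` cdom c -> compact (cmap c @` D).
Proof.
move=> cD Dc; apply: continuous_compact => //.
by apply: continuous_in_subspaceT => x /set_mem/Dc; exact: cmap_cont.
Qed.

Lemma chart_preimage_compact c (K : set 'rV[R]_n) :
  compact K -> K `<=` cmap c @` cdom c -> compact (cinv c @` K).
Proof.
move=> cK Kc; apply: continuous_compact => //.
by apply: continuous_in_subspaceT => p /set_mem/Kc; exact: cinv_cont.
Qed.

End Charts.

Lemma closed_ball_rV_compact (R : realType) (n : nat) (p : 'rV[R]_n) (r : R) :
  compact (closed_ball_ Num.norm p r).
Proof.
apply: bounded_closed_compact; last exact: closed_closed_ball_.
exists (`|p| + r); split; first exact: num_real.
move=> s ps q /= pq; apply: le_trans (ltW ps).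
by rewrite -[q](subKr p) (le_trans (ler_normB _ _))// lerD2l.
Qed.

(** A ball is a union of segments that start at its centre. *)
Lemma ball_connected (R : realType) (V : normedModType R) (p : V) (r : R) :
  0 < r -> connected (ball p r).
Proof.
move=> r0.
pose seg (q : V) := (fun s : R => p + s *: (q - p)) @` `[0, 1]%classic.
have -> : ball p r = \bigcup_(q in ball p r) seg q.
  apply/seteqP; split=> [q pq|x [q pq [s /=]]].
    exists q => //; exists 1 => /=; first by rewrite in_itv/= ler01 lexx.
    by rewrite scale1r addrC subrK.
  rewrite in_itv/= => /andP[s0 s1] <-; move: pq.
  rewrite -ball_normE /ball_ /= opprD addrA subrr sub0r normrN normrZ ger0_norm//.
  by rewrite distrC; apply: le_lt_trans; rewrite ler_piMl.
apply: bigcup_connected.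
  exists p => q _; exists 0 => /=; first by rewrite in_itv/= lexx ler01.
  by rewrite scale0r addr0.
move=> q _; apply: connected_continuous_connected; first exact: segment_connected.
apply: continuous_subspaceT => s; apply: cvgD; first exact: cvg_cst.
by apply: cvgZr_tmp; exact: cvg_id.
Qed.

(** * Coordinate balls as compact domains *)

Definition coordinate_ball (R : realType) (n : nat) (M : topologicalType)
    (c : chart R n M) (p : 'rV[R]_n) (r : R) : set M :=
  cinv c @` closed_ball_ Num.norm p r.

Section SmallDomains.
Context {R : realType} {n : nat} {M : orientedManifold R n}.
Variables (c : chart R n M) (p0 : 'rV[R]_n) (r : R).
Hypotheses (Ac : atlas c) (r0 : 0 < r).
Hypothesis img : closed_ball_ Num.norm p0 (2 * r) `<=` cmap c @` cdom c.

Let coordinate_ball_compact s : s <= 2 * r -> compact (coordinate_ball c p0 s).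
Proof.
move=> sr; apply: chart_preimage_compact; first exact: closed_ball_rV_compact.
by move=> p /= ps; apply: img; exact: le_trans ps sr.
Qed.

Lemma coordinate_ball_domain :
  compact_domain (closure (cinv c @` ball p0 r)) /\
  closure (cinv c @` ball p0 r) `<=` coordinate_ball c p0 r.
Proof.
have rr : r <= 2 * r by rewrite ler_peMl ?ler1n// ltW.
have ballc : ball p0 r `<=` cmap c @` cdom c.
  by move=> p; rewrite -ball_normE => /= pr; apply: img; exact: le_trans (ltW pr) rr.
have sub : closure (cinv c @` ball p0 r) `<=` coordinate_ball c p0 r.
  have cB : closed (coordinate_ball c p0 r).
    apply: compact_closed; first exact: carrier_hausdorff.
    exact: coordinate_ball_compact.
  rewrite [X in _ `<=` X]((closure_id _).1 cB).
  apply: closure_subset => _ [p pr <-]; exists p => //.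
  by move: pr; rewrite -ball_normE => /= /ltW.
split=> //; split.
  apply: (subclosed_compact _ _ sub); first exact: closed_closure.
  exact: coordinate_ball_compact.
exists (cinv c @` ball p0 r); split=> //.
- by apply: chart_preimage_open => //; exact: ball_open.
- by exists (cinv c p0); exists p0 => //; exact: ballxx.
- apply: connected_continuous_connected; first exact: ball_connected.
  by apply: continuous_in_subspaceT => p /set_mem/ballc; exact: cinv_cont.
Qed.

(** A plateau function in the coordinates: 1 on the ball of radius r, and 0
    outside that of radius 2 r. *)
Let bump (x : M) : R := if x \in cdom c
  then Num.max 0 (Num.min 1 (2 - `|p0 - cmap c x| / r)) else 0.

Let bump_support x : bump x != 0 -> coordinate_ball c p0 (2 * r) x.
Proof.
rewrite /bump; case: ifPn => [/set_mem cx|_]; last by rewrite eqxx.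
have [h _|h] := leP `|p0 - cmap c x| (2 * r).
  by exists (cmap c x) => //; exact: cmapK.
rewrite max_l ?eqxx// ge_min; apply/orP; right.
by rewrite subr_le0 ler_pdivlMr// ltW.
Qed.

Let bump_continuous : continuous bump.
Proof.
move=> x; have [cx|ncx] := pselect (cdom c x).
  have near_c : nbhs x (cdom c).
    by apply: open_nbhs_nbhs; split => //; exact: cdom_open.
  pose u (y : M) : R^o := 2 - `|p0 - cmap c y| / r.
  pose h : M -> R^o := (fun=> 0) \max ((fun=> 1) \min u).
  have bh y : cdom c y -> bump y = h y by move=> cy; rewrite /bump mem_set.
  rewrite /prop_for /continuous_at (bh _ cx).
  have cu : {for x, continuous u}.
    apply: cvgB; first exact: cvg_cst.
    apply: cvgM; last exact: cvg_cst.
    apply: cvg_norm.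
    by apply: cvgB; [exact: cvg_cst|exact: cmap_cont].
  have ch : {for x, continuous h}.
    apply: continuous_max; first exact: cvg_cst.
    by apply: continuous_min => //; exact: cvg_cst.
  apply: cvg_trans ch; apply: near_eq_cvg.
  by apply: filterS near_c => y /bh.
(* Outside the chart domain the function vanishes near x, because the compact
   set that carries it is closed, the manifold being Hausdorff. *)
have nx : ~ coordinate_ball c p0 (2 * r) x.
  by move=> [p /img[y cy <-] yx]; apply: ncx; rewrite -yx cmapK.
have near0 : \forall y \near x, 0 = bump y.
  have : open (~` coordinate_ball c p0 (2 * r)).
    apply: closed_openC; apply: compact_closed; first exact: carrier_hausdorff.
    exact: coordinate_ball_compact.
  move=> oB; apply: filterS (open_nbhs_nbhs (conj oB nx)) => y ny.
  by apply/esym/eqP; apply: contrapT => /negP/bump_support.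
have b0 := nbhs_singleton near0.
by apply: cvg_near_cst; apply: filterS near0 => y <-; rewrite -b0.
Qed.

(** A single chart with one plateau function as weight is enough. *)
Lemma coordinate_ball_partition (D : set M) : D `<=` coordinate_ball c p0 r ->
  exists P, @partition_of_unity R n M D P.
Proof.
move=> Dr; exists (@WeightedCharts R n M 1 (fun=> c) (fun=> bump)); split=> //=.
- by move=> _ x; rewrite /bump; case: ifP => // _; rewrite le_max lexx.
- move=> _; have cB : closed (coordinate_ball c p0 (2 * r)).
    apply: compact_closed; first exact: carrier_hausdorff.
    exact: coordinate_ball_compact.
  apply: (@subset_trans _ (coordinate_ball c p0 (2 * r))).
    rewrite [X in _ `<=` X]((closure_id _).1 cB).
    by apply: closure_subset => x; exact: bump_support.
  by move=> _ [p /img[y cy <-] <-]; rewrite cmapK.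
- move=> x /Dr[p /= pr <-]; rewrite big_ord1 /bump.
  have /img[y cy yp] : closed_ball_ Num.norm p0 (2 * r) p.
    by apply: le_trans pr _; rewrite ler_peMl ?ler1n// ltW.
  rewrite -yp cmapK// mem_set// yp min_l ?max_r//.
  by rewrite lerBrDl lerD2r ler_pdivrMr// mul1r.
Qed.

End SmallDomains.

(** * Strict monotonicity of the integral of a density *)

Section DensityIntegral.
Context {R : realType} {n : nat} {M : orientedManifold R n}.

Definition continuous_density (w : forall x : M, chart_at x -> R) : Prop :=
  forall c, atlas c -> forall p, (cmap c @` cdom c) p ->
    {for p, continuous (fun q => w (cinv c q) (at_chart c (cinv c q)))}.

(** In every chart of the partition of unity the weighted integrand of w is at
    most that of w'. At an interior point of D the weights add up to 1, so one
    of them is positive; in its chart the inequality is strict on an open set. *)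
Lemma integral_density_lt (D : set M) (w w' : forall x : M, chart_at x -> R) :
  compact D -> interior D !=set0 ->
  (exists P, @partition_of_unity R n M D P) ->
  continuous_density w -> continuous_density w' ->
  (forall x (c : chart_at x), D x -> w x c < w' x c) ->
  integral_density D w < integral_density D w'.
Proof.
move=> cD [x0 iDx0] exP cw cw' ww'; rewrite /integral_density.
case: pselect => // e; move: (sval (cid e)) (svalP (cid e)) => P /=.
move=> [atlP contP posP suppP sumP].
have [k wk0] : exists k : 'I_(wc_size P), wc_weight k x0 != 0.
  apply: contrapT => /forallNP w0; have := sumP _ (interior_subset iDx0).
  rewrite big1 => [/esym/eqP|k _]; first by rewrite oner_eq0.
  by apply/eqP/negPn/negP; exact: w0.
(* A chart domain may meet D in a non-compact set; the part of D in the support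
   of the weight is compact and carries the integrand. *)
pose supp (k : 'I_(wc_size P)) := closure [set x | wc_weight k x != 0].
pose K k := cmap (wc_chart k) @` (D `&` supp k).
have cK j : compact (K j).
  apply: chart_image_compact; last by move=> x [_ /suppP].
  by apply: compact_closedI => //; exact: closed_closure.
have KD j : K j `<=` cmap (wc_chart j) @` (D `&` cdom (wc_chart j)).
  by apply: image_subset => x [Dx /suppP].
pose f (v : forall x : M, chart_at x -> R) (j : 'I_(wc_size P)) p :=
  wc_weight j (cinv (wc_chart j) p) *
  v (cinv (wc_chart j) p) (at_chart (wc_chart j) (cinv (wc_chart j) p)).
have cf v j : continuous_density v ->
    forall p, K j p -> {for p, continuous (f v j)}.
  move=> cv p [x [Dx /suppP cx] xp].
  have cp : (cmap (wc_chart j) @` cdom (wc_chart j)) p by exists x.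
  have cont_wt : {for p, continuous (wc_weight j \o cinv (wc_chart j))}.
    by apply: continuous_comp; [exact: cinv_cont|exact: contP].
  exact: cvgM cont_wt (cv _ (atlP j) _ cp).
have f0 v j p : (cmap (wc_chart j) @` (D `&` cdom (wc_chart j))) p ->
    ~ K j p -> f v j p = 0.
  move=> [x [Dx cx] <-] nK; rewrite /f cmapK//.
  have /eqP -> : wc_weight j x == 0; last by rewrite mul0r.
  apply: contrapT => /negP wx; apply: nK; exists x => //; split=> //.
  exact: subset_closure.
have f_le j p : K j p -> f w j p <= f w' j p.
  move=> [x [Dx /suppP cx] <-]; rewrite /f cmapK//.
  by apply: ler_wpM2l; [exact: posP|exact/ltW/ww'].
rewrite (bigD1 k)//= [ltRHS](bigD1 k)//=; apply: ltr_leD; last first.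
  apply: ler_sum => j _; apply: (@le_integral_rV _ _ _ (K j)) => //; [|
    |by move=> p Dp Kp; split; exact: f0|exact: f_le]; exact: cf.
pose O := interior D `&` [set x | wc_weight k x != 0].
have Oc : O `<=` cdom (wc_chart k).
  by move=> x [_ wx]; apply: (suppP k); exact: subset_closure.
apply: (@lt_integral_rV _ _ _ (K k) (cmap (wc_chart k) @` O)) => //;
  [exact: cf|exact: cf|by move=> p Dp Kp; split; exact: f0|exact: f_le| | | |].
- apply: chart_image_open => //; apply: openI; first exact: open_interior.
  apply: (@open_comp _ _ _ [set y : R | y != 0]) => [x _|]; first exact: contP.
  exact: open_neq.
- by exists (cmap (wc_chart k) x0); exists x0.
- apply: image_subset => x [/interior_subset Dx wx]; split=> //.
  exact: subset_closure.
- move=> _ [x [/interior_subset Dx wx] <-].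
  have cx : cdom (wc_chart k) x by apply: (suppP k); exact: subset_closure.
  rewrite cmapK// ltr_pM2l; first exact: ww'.
  by rewrite lt_def wx posP.
Qed.

End DensityIntegral.

(** * The volume density of a time orientation *)

Section VolumeCoefficient.
Context {R : realType} {n : nat} {M : orientedManifold R n}.
Variable F : lorentzFinsler M.

Lemma det_jac_gt0 (x : M) (c d : chart_at x) : 0 < \det (jac c d).
Proof.
have [Ac cx] := svalP c; have [Ad dx] := svalP d.
by have [_ ] := atlas_compatible Ac Ad; apply; exists (x : M).
Qed.

(** The components of g^t change by congruence with the Jacobian matrix, so
    their determinant is multiplied by the square of the Jacobian determinant. *)
Lemma volume_coef_jac (t : vector_field M) (x : M) (c d : chart_at x) :
  admissible F (t x) ->
  volume_coef F t c = \det (jac c d) * volume_coef F t d.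
Proof.
move=> ht; have J0 := det_jac_gt0 c d.
rewrite /volume_coef /metric_mx (fundamental_mx_jac c d ht) !det_mulmx det_tr.
by rewrite mulrAC -expr2 normrM sqrtrM// normrX sqrtr_sqr normr_id (gtr0_norm J0).
Qed.

Lemma volume_coef_lt_jac (t t' : vector_field M) (x : M) (c d : chart_at x) :
  admissible F (t x) -> admissible F (t' x) ->
  (volume_coef F t c < volume_coef F t' c) =
  (volume_coef F t d < volume_coef F t' d).
Proof.
move=> ht ht'; rewrite (volume_coef_jac c d ht) (volume_coef_jac c d ht').
by rewrite ltr_pM2l ?det_jac_gt0.
Qed.

Lemma derive_snd (h : 'rV[R]_n * 'rV[R]_n -> R) (u p y : 'rV[R]_n) :
  'D_u (fun z => h (p, z)) y = 'D_(0, u) h (p, y).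
Proof.
rewrite /derive (_ : (fun s : R => _) = fun s : R =>
  s^-1 *: ((h \o shift (p, y)) (s *: (0, u)) - h (p, y)))//.
apply/funext => s /=; congr (_ *: (h _ - _)).
by congr pair; rewrite /= scaler0 add0r.
Qed.

Lemma det_cvg (T : Type) (G : set_system T) (A : T -> 'M[R]_n) (B : 'M[R]_n) :
  Filter G -> (forall i j, A s i j @[s --> G] --> B i j) ->
  \det (A s) @[s --> G] --> \det B.
Proof.
move=> FG cA; rewrite /determinant.
apply: (cvg_big (@add_continuous R)) => s _.
apply: cvgM; first exact: cvg_cst.
exact: (cvg_big (@mul_continuous R)).
Qed.

(** The components of g^t in a chart are second derivatives of L in the
    fibre directions. As such they are values, at the point (q, t(q)) of the
    induced chart, of iterated directional derivatives of a smooth function, so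
    they depend continuously on q; the determinant is a polynomial in them. *)
Lemma volume_coef_continuous (t : vector_field M) :
  time_orientation F t -> continuous_density (volume_coef F t).
Proof.
move=> [smt tt] c Ac p cp.
pose g := induced_expr (lagrangian F) c.
pose y q := t (cinv c q) (at_chart c (cinv c q)).
have cy : {for p, continuous (fun q => (q, y q))}.
  exact: (cvg_pair (@cvg_id _ (nbhs p)) (smt c Ac 0%N p cp)).
have Op : induced_dom (admissible F) c (p, y p).
  split=> //=; rewrite (_ : vect _ _ = t (cinv c p)).
    by have [] := tt (cinv c p).
  apply/val_inj/funext => e /=.
  by have /asboolP/(_ (at_chart c (cinv c p)) e) := coordP (t (cinv c p)).
have entryE q i j : metric_mx F t (at_chart c (cinv c q)) i j =
    2^-1 * 'D_(0, delta_mx 0 i) ('D_(0, delta_mx 0 j) g) (q, y q).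
  rewrite mxE -derive_snd.
  have -> // : (fun z => 'D_(0, delta_mx 0 j) g (q, z)) =
      'D_(delta_mx 0 j) (fun z => g (q, z)).
  by apply/funext => z; rewrite -derive_snd.
have cD u v : {for p, continuous (fun q => 'D_u ('D_v g) (q, y q))}.
  have [_ /(_ v)[_ /(_ u)/(_ _ Op) cDg]] := lagrangian_smooth F Ac 2%N.
  exact: (continuous_comp cy cDg).
have cdet : {for p, continuous
    (fun q => \det (metric_mx F t (at_chart c (cinv c q))))}.
  apply: (@det_cvg _ (nbhs p)) => i j.
  rewrite entryE; under eq_cvg do rewrite entryE.
  by apply: cvgM; [exact: cvg_cst|exact: cD].
pose V q := `|\det (metric_mx F t (at_chart c (cinv c q)))|.
have cV : {for p, continuous V} by exact: cvg_norm cdet.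
have -> : (fun q => volume_coef F t (at_chart c (cinv c q))) = Num.sqrt \o V.
  by [].
apply: continuous_comp; first exact: cV.
exact: sqrt_continuous.
Qed.

(** Each of the two values lies in the set of critical values and bounds it from
    below. *)
Lemma privileged_eq_volume_functional (t0 t0' : vector_field M) (D : set M) :
  privileged F t0 -> privileged F t0' -> compact_domain D ->
  volume_functional F D t0 = volume_functional F D t0'.
Proof.
move=> [_ /(_ D) p0] [_ /(_ D) p0'] cD.
have [v lb] := p0 cD; have [v' lb'] := p0' cD.
by apply: le_anti; apply/andP; split; [exact: lb v'|exact: lb' v].
Qed.

(** The domain is the closure of a coordinate ball around x, small enough for
    the inequality between the coefficients at x to persist on it. *)
Lemma volume_functional_separates (t t' : vector_field M) (x : M)
    (c : chart_at x) :
  time_orientation F t -> time_orientation F t' ->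
  volume_coef F t c < volume_coef F t' c ->
  exists2 D, compact_domain D &
    volume_functional F D t < volume_functional F D t'.
Proof.
move=> Ht Ht' lt_x; have [Ac cx] := svalP c.
have adm s z : time_orientation F s -> admissible F (s z) by move=> [_ /(_ z)[]].
set e := sval c in Ac cx; pose p0 := cmap e x.
pose h s q := volume_coef F s (at_chart e (cinv e q)).
have imgp0 : (cmap e @` cdom e) p0 by exists x.
have ch s : time_orientation F s -> {for p0, continuous (h s)}.
  by move=> Hs; exact: volume_coef_continuous.
have hp0 s : h s p0 = volume_coef F s c.
  by rewrite /h /p0 (cmapK cx) /e at_chartE.
have near_lt : \forall q \near p0, h t q < h t' q.
  have cB : {for p0, continuous (fun q => h t' q - h t q)}.
    exact: cvgB (ch t' Ht') (ch t Ht).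
  have : 0 < h t' p0 - h t p0.
    by rewrite subr_gt0 !hp0.
  move=> /(cvgr_gt _ cB); apply: filterS => q.
  by rewrite subr_gt0.
have near_img : nbhs p0 (cmap e @` cdom e).
  by apply: open_nbhs_nbhs; split => //; exact: cimg_open.
have [r /= r0 sub_r] : nbhs_ball p0
    ((cmap e @` cdom e) `&` [set q | h t q < h t' q]).
  exact/nbhs_ballP/filterI.
(* A ball of radius r / 3 leaves room for the plateau function, which needs a
   closed ball of twice the radius inside the image of the chart. *)
have r3 : 0 < r / 3 by rewrite divr_gt0.
have r23 : 2 * (r / 3) < r.
  by rewrite mulrA ltr_pdivrMr// mulrC ltr_pM2l// ltr_nat.
have r12 : r / 3 <= 2 * (r / 3) by rewrite ler_peMl ?ler1n// ltW.
have cball : closed_ball_ Num.norm p0 (2 * (r / 3)) `<=` ball p0 r.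
  move=> q; rewrite -ball_normE /= => pq; exact: le_lt_trans pq r23.
have img : closed_ball_ Num.norm p0 (2 * (r / 3)) `<=` cmap e @` cdom e.
  by move=> q /cball/sub_r[].
have [domD subD] := coordinate_ball_domain r3 img.
set D := closure _ in domD subD.
exists D => //; apply: integral_density_lt.
- by case: domD.
- exists x; apply: (filterS (@subset_closure _ _)).
  apply: open_nbhs_nbhs; split; last first.
    by exists p0; [exact: ballxx|exact: cmapK].
  apply: chart_preimage_open; first exact: ball_open.
  move=> q; rewrite -ball_normE /= => pq; apply: img.
  exact: le_trans (ltW pq) r12.
- exact: coordinate_ball_partition subD.
- exact: volume_coef_continuous.
- exact: volume_coef_continuous.
- move=> z d /subD[q /= pq qz].
  have qr : ball p0 r q.
    by apply: cball; exact: le_trans pq r12.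
  have [_] := sub_r _ qr; rewrite /= /h qz => lt_q.
  rewrite (volume_coef_lt_jac d (at_chart e z)); [exact: lt_q| |]; exact: adm.
Qed.

End VolumeCoefficient.

Theorem mainTheorem3 (R : realType) (n : nat) (M : orientedManifold R n)
    (F : lorentzFinsler M) (hF : time_orientable F) :
  (forall t0 t0' : vector_field M, privileged F t0 -> privileged F t0' ->
     (forall (x : M) (c : chart_at x),
        Num.sqrt `|\det (metric_mx F t0 c)|%R =
        Num.sqrt `|\det (metric_mx F t0' c)|%R) /\
     volume_form F t0 = volume_form F t0') /\
  ((exists t0 : vector_field M, privileged F t0) ->
   exists! w : (forall x : M, ('I_n -> tangent x) -> R),
     forall t0 : vector_field M, privileged F t0 -> volume_form F t0 = w).
Proof.
have coef_le (t0 t0' : vector_field M) x (c : chart_at x) :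
    privileged F t0 -> privileged F t0' ->
    volume_coef F t0 c <= volume_coef F t0' c.
  move=> p p'; rewrite leNgt; apply/negP => lt_c.
  have [D cD] := volume_functional_separates (proj1 p') (proj1 p) lt_c.
  by rewrite (privileged_eq_volume_functional p p' cD) ltxx.
have coefE (t0 t0' : vector_field M) x (c : chart_at x) :
    privileged F t0 -> privileged F t0' ->
    volume_coef F t0 c = volume_coef F t0' c.
  move=> p p'; apply: le_anti; apply/andP; split; first exact: coef_le p p'.
  exact: coef_le p' p.
have formE (t0 t0' : vector_field M) : privileged F t0 -> privileged F t0' ->
    volume_form F t0 = volume_form F t0'.
  move=> p p'; apply: functional_extensionality_dep => x; apply/funext => v.
  by rewrite /volume_form (coefE _ _ _ _ p p').
split=> [t0 t0' p p'|[t0 p]].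
  by split=> [x c|]; [exact: coefE p p'|exact: formE p p'].
exists (volume_form F t0); split=> [t1 p1|w wP]; first exact: formE p1 p.
exact: wP _ p.
Qed.
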